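(* For every $\varepsilon\in(0,1)$, $$\mathbb{P}\left(\frac{\mathcal{R}_n}{\log n/\log\log n}\in[1-\varepsilon,\,1.5+\varepsilon]\right)=1-O\big(n^{-0.99\varepsilon}\big).$$
   Context: A plane increasing tree on $[n]$ is a rooted tree with vertex set $[n]$ in which every non-root vertex has a larger label than its parent (the root is $1$) and the children of each vertex are linearly ordered. Let $T_n$ be uniformly random among the $(2n-3)!!$ such trees. The rank of a vertex $v$ is the number of edges of a shortest path from $v$ down to a leaf descendant of $v$. $\mathcal{R}_n$ denotes the largest rank of a vertex of $T_n$. $\log$ is the natural logarithm. *)

(* Defs.v *)
From HB Require Import structures.
From mathcomp Require Import all_boot all_order all_algebra.
From mathcomp Require Import all_classical all_reals all_analysis.

Set Implicit Arguments.
Unset Strict Implicit.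
Unset Printing Implicit Defensive.

Import Order.TTheory GRing.Theory Num.Theory.

(* The ordinal i : 'I_n stands for the label i + 1 of [n], so the label 1 is
   the ordinal of value 0.  A candidate tree sends each vertex to the ordered
   list of its children; the bound n on the length of the lists excludes
   nothing, since the children of a vertex are listed without repetition. *)
Definition child_lists (n : nat) := {ffun 'I_n -> n.-bseq 'I_n}.

Definition child n (T : child_lists n) : rel 'I_n := [rel u v | v \in T u].

Definition plane_rooted_tree n (T : child_lists n) (r : 'I_n) : bool :=
  [&& [forall u, uniq (T u)],
      [forall u, ~~ child T u r],
      [forall v, (v != r) ==> (#|[set u | child T u v]%SET| == 1)]
    & [forall v, connect (child T) r v]].

Definition increasing n (T : child_lists n) : bool :=
  [forall u, forall v, child T u v ==> (u < v)].

Definition plane_increasing_tree n (T : child_lists n) : bool :=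
  [exists r : 'I_n, [&& val r == 0, plane_rooted_tree T r & increasing T]].

Definition plane_increasing_trees n : {set child_lists n} :=
  [set T : child_lists n | plane_increasing_tree T]%SET.

Definition leaf n (T : child_lists n) (v : 'I_n) : bool := nilp (T v).

Definition leaf_at_distance n (T : child_lists n) (v : 'I_n) (k : nat) : bool :=
  [exists p : k.-tuple 'I_n, path (child T) v p && leaf T (last v p)].

(* As nth 0 (iota 0 n) k = k for k < n, this [find] is the least k < n at
   which the predicate holds; in an increasing tree there is one, see
   [rankP]. *)
Definition rank n (T : child_lists n) (v : 'I_n) : nat :=
  find (leaf_at_distance T v) (iota 0 n).

Definition max_rank n (T : child_lists n) : nat := \max_(v < n) rank T v.

Definition uniform_finprob (R : realType) (S : finType) (A : {set S})
    (E : pred S) : R :=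
  (#|[set x in A | E x]%SET|%:R / #|A|%:R)%R.

Lemma leaf_at_distance_exists n (T : child_lists n) (v : 'I_n) :
  increasing T -> exists2 k, k < n & leaf_at_distance T v k.
Proof.
move=> /forallP inc.
suff [k kn kl] : exists2 k, k < n - v & leaf_at_distance T v k.
  by exists k => //; exact: leq_trans kn (leq_subr _ _).
have [m] := ubnP (n - v); elim: m v => // m IHm v.
move=> ltm; have [Lv|] := boolP (leaf T v).
  exists 0; first by rewrite subn_gt0.
  by apply/existsP; exists [tuple].
rewrite /leaf /nilp -lt0n -has_predT => /hasP[w vw _].
have ltvw : v < w by move/forallP: (inc v) => /(_ w) /implyP; exact.
have lts : n - w < n - v by rewrite ltn_sub2l.
have [k kw /existsP[p /andP[pp pl]]] := IHm w (leq_trans lts ltm).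
exists k.+1; first exact: leq_ltn_trans kw lts.
by apply/existsP; exists [tuple of w :: p]; rewrite /= pp pl !andbT.
Qed.

Lemma rankP n (T : child_lists n) (v : 'I_n) : increasing T ->
  leaf_at_distance T v (rank T v) /\
  forall k, leaf_at_distance T v k -> rank T v <= k.
Proof.
move=> /(leaf_at_distance_exists v)[k0 k0n k0l].
have hasl : has (leaf_at_distance T v) (iota 0 n).
  by apply/hasP; exists k0; rewrite // mem_iota.
have rn : rank T v < n by rewrite -[X in _ < X](size_iota 0 n) -has_find.
split; first by have := nth_find 0 hasl; rewrite nth_iota.
move=> k kl; rewrite leqNgt; apply/negP => kr.
by have := before_find 0 kr; rewrite nth_iota ?kl // (ltn_trans kr).
Qed.

(* Main.v *)
(** A plane increasing tree is grown by attaching the vertices in increasing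
    order; the new vertex [n] becomes either the leftmost child of an earlier
    vertex or the next right sibling of an earlier non-root vertex. The
    [2n - 1] choices are independent, so a uniform tree is a uniform point of a
    product space.

    Upper tail: the rank of [v] is at most the length of the path of leftmost
    children below [v]. If [a_n(k)] is the expected number of vertices of the
    tree on [n] vertices whose leftmost path has at least [k] edges, then
    [(2n-1) a_(n+1)(k) = (2n-1-k) a_n(k) + a_n(k-1)], whence
    [a_n(k) <= n / (k+1)!].

    Lower tail: cut the last half of the labels into [k + 1] consecutive blocks
    and choose one vertex in each. The event that the chosen vertices form a
    chain of leftmost children to which no other vertex is attached is a
    rectangle of the product space and forces a vertex of rank [k]. Two
    different such events are incompatible if the choices overlap, and nearly
    independent otherwise, so the second moment method applies to their
    number. *)
Require Import Defs.
From mathcomp Require Import all_boot all_order all_algebra.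
From mathcomp Require Import all_classical all_reals all_analysis.
From mathcomp Require Import zify ring lra.
Import Order.TTheory GRing.Theory Num.Theory.
Import numFieldNormedType.Exports.

Set Implicit Arguments.
Unset Strict Implicit.
Unset Printing Implicit Defensive.

(** * Growth histories *)

(* [(u, true)] is the place of a new leftmost child of [u], and [(u, false)] the
   place immediately to the right of [u] in the list of its siblings. *)
Definition slot : Type := (nat * bool)%type.

Definition slots (n : nat) : seq slot :=
  [seq (u, true) | u <- iota 0 n] ++ [seq (u, false) | u <- iota 1 n.-1].

Lemma mem_slots n (x : slot) : (x \in slots n) = (x.2 || (0 < x.1)) && (x.1 < n).
Proof.
case: x => u b; rewrite mem_cat; apply/orP/andP => /=.
  case=> /mapP[w]; rewrite mem_iota => /andP[w0 wn] [-> ->]; first by split.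
  by split=> //; case: n wn => [|n]; rewrite add1n //= ltnS leqn0 (gtn_eqF w0).
case: b => /= -[u0 un]; [left|right]; apply/mapP; exists u; rewrite // mem_iota //=.
by rewrite u0; case: n un.
Qed.

Lemma slots_uniq n : uniq (slots n).
Proof.
rewrite cat_uniq !map_inj_uniq ?iota_uniq /= ?andbT; try by move=> u v [].
by apply/hasPn => x /mapP[u _ ->]; apply/mapP => -[v _ []].
Qed.

Lemma size_slots n : size (slots n.+1) = n.*2.+1.
Proof. by rewrite size_cat !size_map !size_iota /= -addnn addSn. Qed.

Opaque slots.

Definition insert_after (u n : nat) (l : seq nat) : seq nat :=
  flatten [seq if y == u then [:: y; n] else [:: y] | y <- l].

(** A slot [(u, false)] does not name the parent of [u]: the insertion is tried on every list and
    changes only the one that contains [u]. *)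
Definition attach (L : nat -> seq nat) (n : nat) (x : slot) (v : nat) : seq nat :=
  if x.2 then (if v == x.1 then n :: L v else L v)
  else insert_after x.1 n (L v).

(* The head of a history is the slot of the last vertex: in [x :: s] the vertex
   [(size s).+1] is attached at [x], and the root [0] has no slot. *)
Fixpoint histories (m : nat) : seq (seq slot) :=
  if m is m'.+1 then [seq x :: s | s <- histories m', x <- slots m] else [:: [::]].

Arguments histories m : simpl never.

Fixpoint children (s : seq slot) : nat -> seq nat :=
  if s is x :: s' then attach (children s') (size s').+1 x else fun=> [::].

Lemma mem_histories m s : (s \in histories m.+1) =
  if s is x :: s' then (s' \in histories m) && (x \in slots m.+1) else false.
Proof.
apply/allpairsP/idP => [[[s' x] [/= hs hx ->]]|]; first by rewrite hs.
by case: s => // x s /andP[hs hx]; exists (s, x).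
Qed.

Lemma size_history m s : s \in histories m -> size s = m.
Proof.
elim: m s => [|m IH] s; first by rewrite inE => /eqP->.
by rewrite mem_histories; case: s => // x s /andP[/IH /= ->].
Qed.

Lemma histories_uniq m : uniq (histories m).
Proof.
elim: m => // m IH; apply: allpairs_uniq IH (slots_uniq m.+1) _.
by move=> [s x] [s' x'] _ _ /= [-> ->].
Qed.

Lemma mem_insert_after u n l w :
  (w \in insert_after u n l) = (w \in l) || (w == n) && (u \in l).
Proof.
elim: l => [|y l IH] /=; first by rewrite andbF.
rewrite mem_cat IH !inE (eq_sym u y).
by case: (y == u); rewrite !inE; case: (w == y); case: (w == n); case: (w \in l).
Qed.

Lemma insert_after_id u n l : u \notin l -> insert_after u n l = l.
Proof.
elim: l => //= y l IH; rewrite inE negb_or eq_sym => /andP[/negPf yu ul].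
by rewrite /insert_after /= yu /= -/(insert_after u n l) IH.
Qed.

Lemma insert_after_cat u n l1 l2 :
  insert_after u n (l1 ++ l2) = insert_after u n l1 ++ insert_after u n l2.
Proof. by rewrite /insert_after map_cat flatten_cat. Qed.

Lemma insert_after_split u n l1 l2 : u \notin l1 -> u \notin l2 ->
  insert_after u n (l1 ++ u :: l2) = l1 ++ [:: u, n & l2].
Proof.
move=> u1 u2; rewrite insert_after_cat (insert_after_id _ u1).
by rewrite /insert_after /= eqxx /= -/(insert_after u n l2) insert_after_id.
Qed.

Lemma filter_insert_after u n l : n \notin l ->
  seq.filter (predC1 n) (insert_after u n l) = l.
Proof.
elim: l => //= y l IH; rewrite inE negb_or eq_sym => /andP[yn nl].
rewrite /insert_after /= filter_cat -/(insert_after u n l) IH //.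
by case: (y == u) => /=; rewrite yn //= eqxx.
Qed.

Lemma head_insert_after u n l : head n (insert_after u n l) = head n l.
Proof. by case: l => // y l; rewrite /insert_after /=; case: (y == u). Qed.

(** At the first place where the results could differ, one continues with [n] and the other with
    entries of [l]. *)
Lemma insert_after_inj u u' n l : n \notin l -> u \in l -> u' \in l ->
  insert_after u n l = insert_after u' n l -> u = u'.
Proof.
elim: l => // y l IH; rewrite 3!inE negb_or => /andP[ny nl].
(* The default of [head] is [n] itself; as [n] is not in [l], the value [n] can only be that
   default. *)
have hd z : head n (insert_after z n l) = n -> insert_after z n l = [::].
  rewrite head_insert_after; case: (l) nl => //= a l' + an.
  by rewrite inE an eqxx.
have nil z : insert_after z n l = [::] -> l = [::].
  by case: (l) => //= a l'; rewrite /insert_after /=; case: (a == z).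
rewrite {1 2}/insert_after /= -!/(insert_after _ _ _).
rewrite (eq_sym u y) (eq_sym u' y).
case: eqP => [->|yu]; case: eqP => [->|yu'] //=.
- move=> _ u'l [e]; have := hd u'; rewrite -e /= => /(_ erefl) e2.
  by move: (u'l); rewrite (nil u') // e2.
- move=> ul _ [e]; have := hd u; rewrite e /= => /(_ erefl) e2.
  by move: (ul); rewrite (nil u) // e2.
- by move=> ul u'l [e]; apply: IH.
Qed.

(* The children lists [L] of a plane increasing tree with vertices [0 .. n-1];
   reachability from the root follows from the labels increasing. *)
Definition child_system (n : nat) (L : nat -> seq nat) : Prop :=
  [/\ forall v, uniq (L v),
      forall v w, w \in L v -> v < w < n,
      forall w, 0 < w < n -> exists v, w \in L v
    & forall v v' w, w \in L v -> w \in L v' -> v = v'].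

Lemma mem_attach L n x v w : (w \in attach L n x v) =
  (w \in L v) || (w == n) && (if x.2 then v == x.1 else x.1 \in L v).
Proof.
rewrite /attach; case: x => u [] /=; last exact: mem_insert_after.
by case: eqP; rewrite ?andbT ?andbF ?orbF // inE orbC.
Qed.

(** Deleting the newest label undoes an attachment, whatever the slot was. *)
Lemma filter_attach L n x v : n \notin L v ->
  seq.filter (predC1 n) (attach L n x v) = L v.
Proof.
rewrite /attach; case: x => u [] /= nL; last exact: filter_insert_after.
have fL : seq.filter (predC1 n) (L v) = L v.
  by apply/all_filterP/allP => y yL /=; apply: contraNneq nL => <-.
by case: (v == u) => /=; rewrite ?eqxx.
Qed.

Lemma eq_attach L L' n x : L =1 L' -> attach L n x =1 attach L' n x.
Proof. by move=> e v; rewrite /attach e. Qed.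

Lemma attach_uniq L n x v : n \notin L v -> uniq (L v) -> uniq (attach L n x v).
Proof.
rewrite /attach; case: x => u [] /= nL uL; first by case: (_ == _); rewrite //= nL.
have [uin|] := boolP (u \in L v); last by move/insert_after_id->.
case/splitPr: uin uL nL => l1 l2.
rewrite cat_uniq /= negb_or => /and3P[u1 /andP[ul1 h] /andP[ul2 u2]].
rewrite mem_cat inE !negb_or => /and3P[n1 nu n2].
rewrite insert_after_split // cat_uniq /= inE !negb_or ul1 n1 h u1 ul2 n2 u2.
by rewrite eq_sym nu.
Qed.

Lemma attach_child_system n L x : 0 < n -> child_system n L -> x \in slots n ->
  child_system n.+1 (attach L n x).
Proof.
move=> n0 [uL rL eL iL]; rewrite mem_slots => /andP[x0 xn].
have nL v : n \notin L v by apply/negP => /rL; rewrite ltnn andbF.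
split=> [v|v w|w /andP[w0]|v v' w]; first exact: attach_uniq.
- rewrite mem_attach => /orP[/rL/andP[-> /ltnW] //|/andP[/eqP-> h]].
  rewrite ltnSn andbT; case: x.2 h => [/eqP->//|/rL/andP[vx _]].
  exact: ltn_trans vx xn.
- rewrite ltnS leq_eqVlt => /orP[/eqP->|wn].
    case x2: x.2; first by exists x.1; rewrite mem_attach x2 !eqxx orbT.
    have [|v xv] := eL x.1; first by rewrite xn; move: x0; rewrite x2 /= => ->.
    by exists v; rewrite mem_attach x2 xv eqxx orbT.
  have [|v wv] := eL w; first by rewrite w0.
  by exists v; rewrite mem_attach wv.
- rewrite !mem_attach => /orP[h|/andP[/eqP-> h]] /orP[h'|/andP[/eqP e h']].
  + exact: iL h h'.
  + by move: h; rewrite e (negPf (nL _)).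
  + by move: h'; rewrite (negPf (nL _)).
  + by case: x.2 h h' => [/eqP-> /eqP->|]; last exact: iL.
Qed.

Lemma children_child_system m s :
  s \in histories m -> child_system m.+1 (children s).
Proof.
elim: m s => [|m IH] s.
  by rewrite inE => /eqP->; split=> //= -[].
rewrite mem_histories; case: s => // x s /andP[hs hx] /=; rewrite (size_history hs).
by apply: attach_child_system => //; exact: IH.
Qed.

(** The list that receives [n] is the same for both slots. Slots of different kinds cannot agree
    there, since an insertion to the right of a sibling preserves the head of the list. *)
Lemma attach_slot_inj n L x x' : child_system n L -> x \in slots n ->
  x' \in slots n -> attach L n x =1 attach L n x' -> x = x'.
Proof.
move=> [uL rL eL iL]; rewrite !mem_slots => /andP[x0 xn] /andP[x0' xn'] e.
have nL v : n \notin L v by apply/negP => /rL; rewrite ltnn andbF.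
have ind v : (if x.2 then v == x.1 else x.1 \in L v) =
             (if x'.2 then v == x'.1 else x'.1 \in L v).
  have := congr1 (fun l => n \in l) (e v).
  by rewrite !mem_attach eqxx (negPf (nL v)).
have aux u u' : attach L n (u, true) u <> attach L n (u', false) u.
  rewrite /attach /= eqxx; have := nL u; have := head_insert_after u' n (L u).
  case: (L u) => [|y l] //= h; rewrite inE negb_or => /andP[yn _] e2.
  by move: h yn; rewrite -e2 /= => ->; rewrite eqxx.
case: x x' x0 xn x0' xn' e ind => [u [] [u' []]] /= x0 xn x0' xn' e ind.
- by move: (ind u); rewrite eqxx => /esym/eqP->.
- by case: (aux u u').
- by case: (aux u' u); rewrite e.
have [|v uv] := eL u; first by rewrite x0.
have u'v : u' \in L v by rewrite -ind.
by congr pair; apply: insert_after_inj (nL v) uv u'v (e v).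
Qed.

Lemma children_inj m : {in histories m &, forall s s',
  children s =1 children s' -> s = s'}.
Proof.
elim: m => [|m IH]; first by move=> s s'; rewrite !inE => /eqP-> /eqP->.
move=> s s'; rewrite !mem_histories.
case: s s' => // x s [|x' s'] // /andP[hs hx] /andP[hs' hx'].
rewrite /= (size_history hs) (size_history hs') => e.
have nin t v : t \in histories m -> m.+1 \notin children t v.
  by move/children_child_system => [_ r _ _]; apply/negP => /r; rewrite ltnn andbF.
have es : s = s'.
  apply: IH => // v.
  by rewrite -(filter_attach x (nin s v hs)) e filter_attach ?nin.
by subst s'; rewrite (attach_slot_inj (children_child_system hs) hx hx' e).
Qed.

Lemma remove_child_system n L : child_system n.+1 L ->
  child_system n (fun v => seq.filter (predC1 n) (L v)).
Proof.
move=> [uL rL eL iL]; split=> [v|v w|w /andP[w0 wn]|v v' w].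
- exact: filter_uniq.
- rewrite mem_filter /= => /andP[wn /rL/andP[-> wn1]] /=.
  by rewrite ltn_neqAle wn -ltnS.
- have [|v wv] := eL w; first by rewrite w0 ltnW.
  by exists v; rewrite mem_filter wv /= (ltn_eqF wn).
- by rewrite !mem_filter => /andP[_ h] /andP[_ /(iL _ _ _ h)].
Qed.

(** The slot is read off from the left neighbour of [n] among its siblings; if there is none, [n]
    took the leftmost slot of its parent. *)
Lemma remove_attach n L : 0 < n -> child_system n.+1 L ->
  exists2 x, x \in slots n &
    attach (fun v => seq.filter (predC1 n) (L v)) n x =1 L.
Proof.
move=> n0 [uL rL eL iL]; have [|v nv] := eL n; first by rewrite n0 ltnSn.
have fid l : n \notin l -> seq.filter (predC1 n) l = l.
  by move=> nl; apply/all_filterP/allP => y yl /=; apply: contraNneq nl => <-.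
have other w : w != v -> n \notin L w.
  by move=> wv; apply: contra wv => /iL /(_ nv) ->.
have [p1 [p2 Lv]] : exists p1 p2, L v = p1 ++ n :: p2.
  by case/splitPr: nv => p1 p2; exists p1, p2.
have := uL v; rewrite Lv cat_uniq /= negb_or.
move=> /and3P[u1 /andP[np1 h12] /andP[np2 u2]].
case/lastP: p1 => [|p1 u] in Lv u1 np1 h12 *.
  exists (v, true); first by rewrite mem_slots /=; have /andP[] := rL _ _ nv.
  move=> w; rewrite /attach /=; have [->|/other/fid//] := eqVneq w v.
  by rewrite Lv /= eqxx /= fid.
have uv : u \in L v by rewrite Lv mem_cat mem_rcons mem_head.
have un : u != n by move: np1; rewrite mem_rcons inE negb_or eq_sym => /andP[].
exists (u, false).
  rewrite mem_slots /=; have /andP[vu un1] := rL _ _ uv.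
  by rewrite (leq_ltn_trans _ vu) // ltn_neqAle un -ltnS.
move=> w; rewrite /attach /=; have [->|wv] := eqVneq w v.
  rewrite Lv filter_cat /= eqxx /= !fid // cat_rcons insert_after_split //.
  - by rewrite cat_rcons.
  - by move: u1; rewrite rcons_uniq => /andP[].
  - by move: h12 => /hasPn h12; apply/negP => /h12; rewrite /= mem_rcons mem_head.
rewrite fid ?other // insert_after_id //.
by apply: contra wv => /iL /(_ uv) ->.
Qed.

(** With [children_inj] this makes growth a bijection; the factors [2i - 1] for [i = 1, .., m]
    account for the [(2n - 3)!!] trees with [n = m + 1]. *)
Lemma children_surj m L : child_system m.+1 L ->
  exists2 s, s \in histories m & children s =1 L.
Proof.
elim: m L => [|m IH] L VL.
  exists [::] => // v /=; case E: (L v) => [//|w l]; have [_ r _ _] := VL.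
  have := r v w; rewrite E mem_head ltnS leqn0 => /(_ isT)/andP[+ /eqP w0].
  by rewrite w0.
have [s hs es] := IH _ (remove_child_system VL).
have [//|x hx ex] := remove_attach _ VL.
exists (x :: s); first by rewrite mem_histories hs.
by move=> v /=; rewrite (size_history hs) -ex; apply: eq_attach.
Qed.

(** * Leftmost paths *)

(* Attaching [n] as leftmost child of a vertex of a leftmost path diverts the
   path from that vertex to [n]. *)
Definition extend_left (n : nat) (x : slot) (p : seq nat) : seq nat :=
  if x.2 && (x.1 \in p) then rcons (take (index x.1 p).+1 p) n else p.

(** One path per vertex, that of the newest vertex first. The recursion follows the growth rather
    than the finished tree, so that a new slot acts on each path separately. *)
Fixpoint left_paths (s : seq slot) : seq (seq nat) :=
  if s is x :: s' then
    [:: (size s').+1] :: [seq extend_left (size s').+1 x p | p <- left_paths s']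
  else [:: [:: 0]].

Lemma size_left_paths s : size (left_paths s) = (size s).+1.
Proof. by elim: s => //= x s IH; rewrite size_map IH. Qed.

Lemma size_extend_left n x p : size (extend_left n x p) =
  if x.2 && (x.1 \in p) then (index x.1 p).+2 else size p.
Proof.
rewrite /extend_left; case: ifP => // /andP[_ xp].
by rewrite size_rcons size_takel // index_mem.
Qed.

Lemma left_paths_uniq s p : p \in left_paths s ->
  uniq p /\ {in p, forall v, v < (size s).+1}.
Proof.
elim: s p => [|x s IH] p /=.
  by rewrite inE => /eqP->; split=> // v; rewrite inE => /eqP->.
rewrite inE => /orP[/eqP->|/mapP[q /IH[uq bq] ->]].
  by split=> // v; rewrite inE => /eqP->.
rewrite /extend_left; case: ifP => _; last by split=> // v /bq /ltnW.
split=> [|v].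
  rewrite rcons_uniq take_uniq // andbT.
  by apply/negP => /mem_take /bq; rewrite ltnn.
by rewrite mem_rcons inE => /orP[/eqP->//|/mem_take/bq/ltnW].
Qed.

Definition left_path (L : nat -> seq nat) (v : nat) (p : seq nat) : bool :=
  path (fun a b => ohead (L a) == Some b) v p && nilp (L (last v p)).

Lemma ohead_insert_after u n l : ohead (insert_after u n l) = ohead l.
Proof. by case: l => // y l; rewrite /insert_after /=; case: (y == u). Qed.

Lemma eq_in_left_path L L' v p : {in v :: p, L =1 L'} ->
  left_path L v p = left_path L' v p.
Proof.
move=> e; rewrite /left_path (e (last v p)) ?mem_last //; congr andb.
elim: p v e => //= w p IH v e; rewrite e ?mem_head // IH // => z zp.
by apply: e; rewrite inE zp orbT.
Qed.

(** Ties the recursive paths to the tree. An old path changes only when the leftmost slot of one of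
    its vertices is taken; it is then cut there and ends in the new leaf. *)
Lemma left_paths_exist m s : s \in histories m -> forall v, v < m.+1 ->
  exists2 p, v :: p \in left_paths s & left_path (children s) v p.
Proof.
elim: m s => [|m IH] s.
  by rewrite inE => /eqP-> [|v] // _; exists [::].
rewrite mem_histories; case: s => // x s /andP[hs hx] v /=.
have sys := children_child_system hs; have [_ rL _ _] := sys.
move: hx; rewrite mem_slots => /andP[_ xm].
rewrite (size_history hs); set n := m.+1; set L := children s.
have Ln : L n = [::].
  case E: (L n) => [//|w l]; have := rL n w.
  by rewrite -/L E mem_head => /(_ isT) /andP[/ltn_trans h /h]; rewrite ltnn.
have aLn : attach L n x n = [::].
  by rewrite /attach Ln; case: x.2 => //; rewrite gtn_eqF.
rewrite ltnS leq_eqVlt => /orP[/eqP->|vn].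
  by exists [::]; rewrite ?mem_head // /left_path /= aLn.
have [p pin pL] := IH _ hs v vn.
have [uvp bvp] := left_paths_uniq pin.
have [/andP[x2 xp]|nx] := boolP (x.2 && (x.1 \in v :: p)); last first.
  exists p.
    rewrite inE; apply/orP; right; apply/mapP; exists (v :: p) => //.
    by rewrite /extend_left (negPf nx).
  move: nx; rewrite /attach; case: x.2 => /= [nx|_].
    rewrite -(eq_in_left_path (L := L)) // => w wp.
    by case: eqP => // e; rewrite -e wp in nx.
  move: pL; rewrite /left_path => /andP[pp nn]; apply/andP; split.
    rewrite (eq_path (e' := fun a b => ohead (L a) == Some b)) // => a b.
    by rewrite ohead_insert_after.
  by move/nilP: nn; rewrite -/L => ->.
(* [p1] leads from [v] to [x.1], so [x.1] has index [size p1] in the path and the cut keeps exactly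
   [v :: p1]. *)
case/splitPl: xp pin pL uvp bvp => p1 p2 lp1 pin pL uvp bvp.
exists (rcons p1 n).
  rewrite inE; apply/orP; right; apply/mapP; exists (v :: p1 ++ p2) => //.
  have up1 : uniq (v :: p1) by move: uvp; rewrite -cat_cons cat_uniq => /andP[].
  have ix : index x.1 (v :: p1 ++ p2) = size p1.
    by rewrite -cat_cons index_cat -lp1 mem_last index_last.
  rewrite /extend_left x2 ix -cat_cons mem_cat -lp1 mem_last /=.
  by rewrite take_size_cat.
move: pL; rewrite /left_path last_rcons aLn andbT => /andP[].
rewrite cat_path rcons_path => /andP[pp1 _] _; apply/andP; split; last first.
  by rewrite lp1 /attach x2 eqxx.
have : uniq (v :: p1) by move: uvp; rewrite -cat_cons cat_uniq => /andP[].
move: pp1 lp1; rewrite /attach x2 -/L.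
elim: p1 v {pin uvp bvp vn} => //= w p1 IHp v /andP[vw pw] lw /andP[vnp uw].
rewrite IHp // andbT; case: (v =P x.1) => // vx.
by move: vnp; rewrite vx -lw mem_last.
Qed.

(** * The expected number of long leftmost paths *)

Definition long_left_paths (k : nat) (s : seq slot) : nat :=
  count (fun p => k < size p) (left_paths s).

(** A path with more than [k] vertices is spoilt by the leftmost slots of its first [k - 1]
    vertices; one with exactly [k] vertices becomes long only through its last vertex. The
    coefficient is [k] and not [k - 1] because the last term counts the long paths once more. *)
Lemma count_extend_left n k p : 0 < n -> 0 < k -> uniq p ->
    {in p, forall v, v < n} ->
  count (fun x => k < size (extend_left n x p)) (slots n) + k * (k < size p) <=
  (n.*2.-1) * (k < size p) + (k.-1 < size p).
Proof.
move=> n0 k0 up bp; set a := fun x => _.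
have szs : size (slots n) = n.*2.-1.
  by case: n n0 {a bp} => // n _; rewrite size_slots.
have [kp|pk] := ltnP k (size p).
  rewrite (leq_ltn_trans (leq_pred k) kp) !muln1.
  have : k.-1 <= count (predC a) (slots n).
    rewrite -size_filter.
    have -> : k.-1 = size [seq (u, true) | u <- take k.-1 p].
      by rewrite size_map size_takel // (leq_trans (leq_pred k)) // ltnW.
    apply: uniq_leq_size.
      by rewrite map_inj_uniq ?take_uniq // => u v [].
    move=> _ /mapP[u ut ->]; have up' := mem_take ut.
    rewrite mem_filter mem_slots /= (bp _ up') andbT /a size_extend_left /= up'.
    have := ut; rewrite in_take // => iu.
    by rewrite -leqNgt; move: iu; lia.
  by have := count_predC a (slots n); rewrite szs; lia.
rewrite !muln0 addn0 add0n.
apply: (@leq_trans (size [seq (u, true) | u <- drop k.-1 p])); last first.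
  by rewrite size_map size_drop; move: pk k0; case: ltnP; lia.
rewrite -size_filter; apply: uniq_leq_size; first exact/filter_uniq/slots_uniq.
move=> [u b]; rewrite mem_filter /a size_extend_left mem_slots /=.
case: ifP => [/andP[-> up'] /andP[ku _]|_]; last by rewrite ltnNge pk.
apply/mapP; exists u => //; move: up'; rewrite -{1}(cat_take_drop k.-1 p) mem_cat.
case/orP => // ut; have := ut; rewrite in_take; last exact: mem_take ut.
by move: ku; lia.
Qed.

(** [count_extend_left] summed over the paths; the path of the new vertex has one vertex and does
    not count, as [0 < k]. *)
Lemma sum_long_left_paths k s : 0 < k ->
  \sum_(x <- slots (size s).+1) long_left_paths k (x :: s)
    + k * long_left_paths k s
  <= (size s).*2.+1 * long_left_paths k s + long_left_paths k.-1 s.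
Proof.
move=> k0; have cE T (q : pred T) l : count q l = \sum_(p <- l) q p.
  by rewrite -sum1_count big_mkcond.
rewrite /long_left_paths /=.
under eq_bigr => x _ do rewrite ltnNge k0 add0n count_map cE.
rewrite exchange_big /= !cE !big_distrr /= -!big_split /= !big_seq.
apply: leq_sum => p /left_paths_uniq[up bp].
by have := @count_extend_left (size s).+1 k p isT k0 up bp; rewrite cE doubleS.
Qed.

Lemma sum_histories m (f : seq slot -> nat) :
  \sum_(s <- histories m.+1) f s =
  \sum_(s <- histories m) \sum_(x <- slots m.+1) f (x :: s).
Proof. exact: big_allpairs_dep. Qed.

Lemma size_histories m : size (histories m.+1) = m.*2.+1 * size (histories m).
Proof. by rewrite [LHS]size_allpairs size_slots mulnC. Qed.

Lemma long_left_paths_bound k m :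
  (\sum_(s <- histories m) long_left_paths k s) * (k.+1)`! <=
  m.+1 * size (histories m).
Proof.
elim: m k => [|m IH] k.
  by rewrite big_seq1 /long_left_paths /=; case: k.
have [->|k0] := posnP k.
  rewrite muln1 mulnC -sum1_size big_distrl /= !big_seq; apply: leq_sum => s hs.
  by rewrite mul1n (leq_trans (count_size _ _)) // size_left_paths (size_history hs).
(* The recurrence is used with the truncated difference [2m + 1 - k]. For larger [k] the sum
   vanishes, since a path has at most [m + 2] vertices. *)
have [km|mk] := leqP k m.*2.+1; last first.
  rewrite big_seq big1 ?mul0n // => s hs.
  apply/eqP; rewrite /long_left_paths -leqn0 leqNgt -has_count; apply/hasPn => p.
  move=> /left_paths_uniq[up bp]; rewrite -leqNgt.
  have : size p <= size (iota 0 m.+2).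
    by apply: uniq_leq_size => // v /bp; rewrite mem_iota (size_history hs).
  by rewrite size_iota => /leq_trans; apply; move: mk; rewrite -addnn; lia.
rewrite sum_histories size_histories.
have step : \sum_(s <- histories m) \sum_(x <- slots m.+1) long_left_paths k (x :: s)
    + k * \sum_(s <- histories m) long_left_paths k s <=
  m.*2.+1 * (\sum_(s <- histories m) long_left_paths k s) +
  \sum_(s <- histories m) long_left_paths k.-1 s.
  rewrite !big_distrr /= -!big_split /= !big_seq; apply: leq_sum => s hs.
  by have := sum_long_left_paths s k0; rewrite (size_history hs).
have := IH k; have := IH k.-1; rewrite prednK // [k.+1`!]factS.
move: step; set F := k`!; set H := size _.
set a := \sum_(_ <- _) \sum_(_ <- _) _.
set b := \sum_(_ <- _) _; set c := \sum_(_ <- _) _.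
move=> step Hc Hb.
have : a * (k.+1 * F) <= (m.*2.+1 - k) * (b * (k.+1 * F)) + k.+1 * (c * F).
  have : a <= (m.*2.+1 - k) * b + c by rewrite mulnBl; move: step km; nia.
  by rewrite -(leq_pmul2r (m := k.+1 * F)) ?muln_gt0 ?fact_gt0 //; nia.
move=> /leq_trans; apply.
apply: (@leq_trans ((m.*2.+1 - k) * (m.+1 * H) + k.+1 * (m.+1 * H))).
  by rewrite leq_add // leq_mul2l ?Hb ?Hc orbT.
rewrite -mulnDl.
(* With [n = m + 1] the two weights add up to [2n], and [2n * n <= (n + 1) * (2n - 1)] closes the
   induction. *)
have -> : m.*2.+1 - k + k.+1 = m.*2.+2 by move: km; rewrite -addnn; lia.
by rewrite !mulnA leq_mul2r; apply/orP; right; rewrite -addnn; nia.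
Qed.

(** * Isolated chains *)

(** The value [(0, true)] is a default, taken at the root and at labels beyond the tree. *)
Fixpoint slot_of (s : seq slot) (i : nat) : slot :=
  if s is x :: s' then (if i == (size s').+1 then x else slot_of s' i)
  else (0, true).

Lemma slot_of_slots m s i : s \in histories m -> 0 < i <= m ->
  slot_of s i \in slots i.
Proof.
elim: m s => [|m IH] s; first by case: i.
rewrite mem_histories; case: s => // x s /andP[hs hx] /andP[i0 im] /=.
rewrite (size_history hs); case: eqP => [->//|/eqP ne].
by apply: IH; rewrite // i0 -ltnS ltn_neqAle ne im.
Qed.

(** Later attachments never change a parent. The description is recursive: a right slot refers to a
    sibling with a smaller label. *)
Lemma mem_children m s v w : s \in histories m ->
  (w \in children s v) = (0 < w <= m) &&
    (if (slot_of s w).2 then v == (slot_of s w).1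
     else (slot_of s w).1 \in children s v).
Proof.
elim: m s => [|m IH] s; first by rewrite inE => /eqP->; case: w.
rewrite mem_histories; case: s => // x s /andP[hs hx] /=.
rewrite (size_history hs) mem_attach; have [_ rL _ _] := children_child_system hs.
have nL u : m.+1 \notin children s u by apply/negP => /rL; rewrite ltnn andbF.
have [->|ne] := eqVneq w m.+1.
  rewrite (negPf (nL v)) /= leqnn; case x2: x.2 => //.
  rewrite mem_attach x2; case: (x.1 =P m.+1) => [e|]; last by rewrite orbF.
  by move: hx; rewrite mem_slots e ltnn andbF.
rewrite orbF (IH _ hs).
have -> : (w <= m.+1) = (w <= m) by rewrite [RHS]leq_eqVlt; lia.
have [/andP[w0 wm]|//] := boolP (0 < w <= m).
case: ifP => // _; rewrite mem_attach.
have := slot_of_slots hs (introT andP (conj w0 wm)).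
rewrite mem_slots => /andP[_ yw].
by rewrite (ltn_eqF (leq_trans yw _)) // ?orbF // ltnW.
Qed.

Fixpoint rect (A : nat -> pred slot) (s : seq slot) : bool :=
  if s is x :: s' then A (size s').+1 x && rect A s' else true.

Lemma rect_slot_of A s i : rect A s -> 0 < i <= size s -> A i (slot_of s i).
Proof.
elim: s => [|x s IH] /=; first by case: i.
move=> /andP[Ax rs] /andP[i0 im]; case: eqP => [->//|/eqP ne].
by apply: IH; rewrite // i0 -ltnS ltn_neqAle ne im.
Qed.

Lemma rectI A B s : rect A s && rect B s = rect (fun i x => A i x && B i x) s.
Proof. by elim: s => //= x s <-; rewrite andbACA. Qed.

(** The slots available to a label do not depend on the earlier choices, so the count factorises. *)
Lemma count_rect m A :
  count (rect A) (histories m) = \prod_(i < m) count (A i.+1) (slots i.+1).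
Proof.
elim: m => [|m IH]; first by rewrite big_ord0.
rewrite big_ord_recr.
rewrite -[RHS]/((\prod_(i < m) count (A i.+1) (slots i.+1)) *
                count (A m.+1) (slots m.+1)) -IH.
have cE T (q : pred T) l : count q l = \sum_(p <- l) q p.
  by rewrite -sum1_count big_mkcond.
rewrite !cE sum_histories [RHS]big_distrl big_seq [RHS]big_seq.
apply: eq_bigr => s hs.
rewrite [RHS]big_distrr; apply: eq_bigr => x _.
by rewrite /= (size_history hs) mulnb andbC.
Qed.

(* Among [c 1, .., c k] each vertex takes the leftmost slot of its predecessor in
   the chain, and no other vertex takes a slot of a vertex [c j]. *)
Definition chain_slot (k : nat) (c : nat -> nat) (i : nat) (x : slot) : bool :=
  all (fun j => (i == c j.+1) ==> (x == (c j, true))) (iota 0 k) &&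
  all (fun j => (x.1 == c j) ==> (j < k) && (i == c j.+1)) (iota 0 k.+1).

Lemma chain_slotP k c i x : reflect
  ((forall j, j < k -> i = c j.+1 -> x = (c j, true)) /\
   (forall j, j <= k -> x.1 = c j -> j < k /\ i = c j.+1))
  (chain_slot k c i x).
Proof.
apply: (iffP andP) => -[h1 h2]; split.
- move=> j jk ij; move/allP: h1 => /(_ j); rewrite mem_iota jk => /(_ isT).
  by rewrite ij eqxx => /eqP.
- move=> j jk xj; move/allP: h2 => /(_ j); rewrite mem_iota ltnS jk => /(_ isT).
  by rewrite xj eqxx => /andP[-> /eqP].
- apply/allP => j; rewrite mem_iota => /andP[_ jk].
  by apply/implyP => /eqP ij; apply/eqP; apply: h1.
- apply/allP => j; rewrite mem_iota ltnS => /andP[_ jk].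
  by apply/implyP => /eqP ij; have [-> ->] := h2 j jk ij; rewrite eqxx.
Qed.

Definition increasing_upto (k : nat) (c : nat -> nat) : Prop :=
  forall i j, i < j <= k -> c i < c j.

Section Chain.
Variables (k m : nat) (c : nat -> nat) (s : seq slot).
Hypotheses (c_incr : increasing_upto k c) (ck : c k <= m).
Hypotheses (hs : s \in histories m) (rs : rect (chain_slot k c) s).

Lemma chain_le j : j <= k -> c j <= m.
Proof.
rewrite leq_eqVlt => /orP[/eqP->//|jk].
by apply: leq_trans (ltnW _) ck; apply: c_incr; rewrite jk leqnn.
Qed.

Lemma slot_of_chain j : j < k -> slot_of s (c j.+1) = (c j, true).
Proof.
move=> jk; have h : 0 < c j.+1 <= size s.
  rewrite (size_history hs) chain_le // andbT.
  by apply: leq_ltn_trans (c_incr (i := j) _); rewrite // ltnSn.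
by have /chain_slotP[/(_ j jk erefl)] := rect_slot_of rs h.
Qed.

(** Strong induction on [w]. A child in a right slot would stand next to [c j.+1]; only [c j.+2] may
    use a slot of that vertex, and it uses the leftmost one. *)
Lemma chain_children j w : j <= k ->
  (w \in children s (c j)) = (j < k) && (w == c j.+1).
Proof.
move=> jk; apply/idP/idP => [|/andP[jk' /eqP->]]; last first.
  rewrite (mem_children _ _ hs) slot_of_chain // eqxx andbT chain_le // andbT.
  by apply: leq_ltn_trans (c_incr (i := j) _); rewrite // ltnSn.
have [n] := ubnP w; elim: n w => // n IH w wn wc.
move: (wc); rewrite (mem_children _ _ hs) => /andP[wm].
have wm' : 0 < w <= size s by rewrite (size_history hs).
have /chain_slotP[_ h2] := rect_slot_of rs wm'.
case: ifP => _ => [/eqP/esym/(h2 _ jk)[-> ->]|ch]; first by rewrite eqxx.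
have := slot_of_slots hs wm; rewrite mem_slots => /andP[_ lt].
have /andP[jk' /eqP e] := IH _ (leq_trans lt wn) ch.
have [j1k e2] := h2 _ jk' e.
have : slot_of s w = (c j.+1, true) by rewrite e2 slot_of_chain.
move=> e3; move: wc; rewrite (mem_children _ _ hs) e3 => /andP[_ /eqP /= e4].
by have := c_incr (i := j) (j := j.+1); rewrite ltnSn jk' -e4 ltnn => /(_ isT).
Qed.

End Chain.

(** Agreement spreads both ways: the slot of [c i.+1] names [c i], and [c i.+1] is the only vertex
    attached at a slot of [c i]. *)
Lemma rect_chain_inj k m c c' s : increasing_upto k c -> increasing_upto k c' ->
    c k <= m -> c' k <= m -> s \in histories m ->
    rect (chain_slot k c) s -> rect (chain_slot k c') s ->
  forall j, j <= k -> c j = c' j -> forall i, i <= k -> c i = c' i.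
Proof.
move=> ci ci' ck ck' hs r r' j jk e.
have up i : i < k -> c i = c' i -> c i.+1 = c' i.+1.
  move=> ik ei; have h := slot_of_chain ci' ck' hs r' ik.
  have b : 0 < c' i.+1 <= size s.
    rewrite (size_history hs) (chain_le ci' ck') // andbT.
    by apply: leq_ltn_trans (ci' i _ _); rewrite // ltnSn.
  have /chain_slotP[_ /(_ i (ltnW ik))] := rect_slot_of r b.
  by rewrite h => /(_ (esym ei))[].
have down i : i < k -> c i.+1 = c' i.+1 -> c i = c' i.
  move=> ik ei; have := slot_of_chain ci' ck' hs r' ik.
  by rewrite -ei (slot_of_chain ci ck hs r ik) => -[].
have e0 : c 0 = c' 0.
  by elim: j jk e => // j IH jk /(down _ jk) /IH; apply; exact: ltnW.
by elim=> // i IH ik; apply: up => //; apply: IH; exact: ltnW.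
Qed.

(** The labels whose slot is forced; [c 0] is left out, since the chain may start anywhere in the
    tree. *)
Definition chain_image (k : nat) (c : nat -> nat) : seq nat :=
  [seq c j.+1 | j <- iota 0 k].

Lemma count_chain_slot_image k c i : increasing_upto k c ->
  i \in chain_image k c -> count (chain_slot k c i) (slots i) = 1.
Proof.
move=> ci /mapP[j]; rewrite mem_iota => /andP[_ jk] ->.
have <- : count_mem (c j, true) (slots (c j.+1)) = 1.
  by rewrite count_uniq_mem ?slots_uniq // mem_slots /= ci // ltnSn.
apply: eq_in_count => x xs; apply/chain_slotP/eqP => [[/(_ j jk erefl)]//|->].
have inj a b : a <= k -> b <= k -> c a = c b -> a = b.
  by move=> ak bk e; case: (ltngtP a b) => // h;
    [have := ci a b | have := ci b a]; rewrite h ?ak ?bk e ltnn => /(_ isT).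
split=> [j' j'k e|j' j'k /= e].
  by have [->] := inj _ _ jk j'k e.
by rewrite -(inj _ _ (ltnW jk) j'k e).
Qed.

(** Only the two slots of each of the [k + 1] chain vertices are forbidden. *)
Lemma count_chain_slot k c i : i \notin chain_image k c ->
  size (slots i) <= count (chain_slot k c i) (slots i) + k.+1.*2.
Proof.
move=> ni; rewrite -(count_predC (chain_slot k c i)) leq_add2l -size_filter.
pose F := [seq (c j, b) | j <- iota 0 k.+1, b <- [:: true; false]].
have -> : k.+1.*2 = size F by rewrite size_allpairs size_iota muln2.
apply: uniq_leq_size; first exact/filter_uniq/slots_uniq.
move=> [u b]; rewrite mem_filter => /andP[/= h _].
have [/hasP[j jk /eqP ->]|nh] := boolP (has (fun j => u == c j) (iota 0 k.+1)).
  by apply/allpairsP; exists (j, b); split=> //; case: (b).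
case/chain_slotP: h; split=> [j jk e|j jk /= e].
  by case/mapP: ni; exists j; rewrite // mem_iota.
by case/hasP: nh; exists j; rewrite ?mem_iota ?ltnS // e.
Qed.

(** When [i] is attached, no vertex of the chain is present yet. *)
Lemma count_chain_slot0 k c i : increasing_upto k c -> i <= c 0 ->
  count (chain_slot k c i) (slots i) = size (slots i).
Proof.
move=> ci ic; apply/eqP; rewrite -all_count; apply/allP => x.
have c0 j : j <= k -> c 0 <= c j.
  by case: j => // j jk; apply: ltnW; apply: ci.
rewrite mem_slots => /andP[_ xi]; apply/chain_slotP; split=> j jk e.
  by move: (ci 0 j.+1 jk); rewrite -e ltnNge ic.
by move: (leq_trans xi (leq_trans ic (c0 _ jk))); rewrite e ltnn.
Qed.

(** The slots forbidden by two disjoint chains are disjoint sets, so the two conditions are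
    negatively correlated. *)
Lemma count_chain_slot_disjoint k c c' i :
    i \notin chain_image k c -> i \notin chain_image k c' ->
    (forall j j', j <= k -> j' <= k -> c j != c' j') ->
  count (fun x => chain_slot k c i x && chain_slot k c' i x) (slots i)
    * size (slots i) <=
  count (chain_slot k c i) (slots i) * count (chain_slot k c' i) (slots i).
Proof.
move=> ni ni' dis; set P := chain_slot k c i; set Q := chain_slot k c' i.
have PQ : count (predU P Q) (slots i) = size (slots i).
  apply/eqP; rewrite -all_count; apply/allP => x _ /=.
  have ok d : i \notin chain_image k d -> (forall j, j <= k -> x.1 <> d j) ->
      chain_slot k d i x.
    move=> nd h; apply/chain_slotP; split=> j jk e; last by case: (h j jk).
    by case/mapP: nd; exists j; rewrite // mem_iota.
  apply/orP; case: (boolP (has (fun j => x.1 == c j) (iota 0 k.+1))).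
    move=> /hasP[j]; rewrite mem_iota ltnS => jk /eqP xj; right; apply: ok => //.
    by move=> j' j'k; rewrite xj; apply/eqP; apply: dis.
  move=> /hasPn h; left; apply: ok => // j jk; apply/eqP; apply: h.
  by rewrite mem_iota ltnS.
have := count_predUI P Q (slots i); rewrite PQ.
have := count_size P (slots i); have := count_size Q (slots i).
have -> : count (fun x => P x && Q x) (slots i) = count (predI P Q) (slots i) by [].
move: (count P _) (count Q _) (count (predI P Q) _) (size _) => a b d r br ar e.
(* [u] and [v] count the slots forbidden by the first and by the second chain; the two sides then
   differ by [u * v]. *)
have [u [v [-> -> ->]]] : exists u v, [/\ r = d + u + v, a = d + v & b = d + u].
  by exists (r - a), (r - b); split; lia.
by rewrite -addnA mulnDr [X in _ <= X]mulnDl !mulnDr [v * d]mulnC; lia.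
Qed.

Local Open Scope classical_set_scope.
Local Open Scope ring_scope.

(** * Trees and histories *)

(** [insub_bseq] and [inord] fall back on defaults for long lists and large labels; neither happens
    when [L] is a child system. *)
Definition tree_of (m : nat) (L : nat -> seq nat) : child_lists m.+1 :=
  [ffun u : 'I_m.+1 => insub_bseq m.+1 (map inord (L u))].

Lemma child_system_size n L v : child_system n L -> (size (L v) <= n)%N.
Proof.
move=> [uL rL _ _]; rewrite -[n](size_iota 0); apply: uniq_leq_size => // w.
by rewrite mem_iota => /rL /andP[_ ->].
Qed.

Lemma tree_ofE m L (u : 'I_m.+1) : child_system m.+1 L ->
  map val (tree_of m L u) = L u.
Proof.
move=> sysL; have [uL rL _ _] := sysL.
rewrite ffunE /insub_bseq insubdK; last first.
  by rewrite unfold_in /= size_map; exact: child_system_size.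
by rewrite -map_comp map_id_in // => w /rL/andP[_ wn]; rewrite /= inordK.
Qed.

Lemma mem_tree_of m L (u v : 'I_m.+1) : child_system m.+1 L ->
  (v \in tree_of m L u) = (val v \in L u).
Proof. by move=> sysL; rewrite -tree_ofE // mem_map //; exact: val_inj. Qed.

Lemma tree_of_plane_increasing m L : child_system m.+1 L ->
  plane_increasing_tree (tree_of m L).
Proof.
move=> sysL; have [uL rL eL iL] := sysL; apply/existsP; exists ord0.
have chE (u v : 'I_m.+1) : child (tree_of m L) u v = (val v \in L u).
  exact: mem_tree_of.
apply/and3P; split=> //; last first.
  apply/forallP => u; apply/forallP => v; apply/implyP.
  by rewrite chE => /rL/andP[].
apply/and4P; split.
- by apply/forallP => u; rewrite -(map_inj_uniq val_inj) tree_ofE.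
- by apply/forallP => u; rewrite chE; apply/negP => /rL; rewrite ltn0.
- apply/forallP => v; apply/implyP => v0.
  have [|u vu] := eL (val v); first by rewrite ltn_ord andbT lt0n.
  have un : (u < m.+1)%N.
    by have /andP[uv _] := rL _ _ vu; exact: ltn_trans uv (ltn_ord v).
  apply/cards1P; exists (Ordinal un); apply/setP => w; rewrite !inE chE.
  apply/idP/eqP => [wv|->//]; apply: val_inj; exact: iL wv vu.
- apply/forallP => v; have [k] := ubnP (val v); elim: k v => // k IH v vk.
  have [->//|v0] := eqVneq v ord0.
  have [|u vu] := eL (val v); first by rewrite ltn_ord andbT lt0n.
  have /andP[uv _] := rL _ _ vu; have un := ltn_trans uv (ltn_ord v).
  apply: (connect_trans (IH (Ordinal un) _)) => /=.
    by rewrite ltnS in vk; exact: leq_trans uv vk.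
  by apply: connect1; rewrite chE.
Qed.

Lemma tree_of_surj m (T : child_lists m.+1) : plane_increasing_tree T ->
  exists2 L, child_system m.+1 L & T = tree_of m L.
Proof.
move=> /existsP[r /and3P[/eqP r0 /and4P[/forallP uT /forallP rT /forallP pT _] inc]].
have {}inc u v : child T u v -> (u < v)%N.
  by move: inc => /forallP/(_ u)/forallP/(_ v)/implyP.
pose L v := if insub v is Some u then map val (T u) else [::].
have LE (u : 'I_m.+1) : L u = map val (T u) by rewrite /L valK.
have memL v w : w \in L v -> exists u x : 'I_m.+1, [/\ v = u, w = x & child T u x].
  rewrite /L; case: insubP => // u _ uv /mapP[x xu ->]; exists u, x.
  by rewrite uv.
have sysL : child_system m.+1 L; last first.
  exists L => //; apply/ffunP => u; apply: val_inj; apply: (inj_map val_inj).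
  by rewrite /= tree_ofE // LE.
split=> [v|v w|w /andP[w0 wn]|v v' w].
- by rewrite /L; case: insubP => // u _ _; rewrite map_inj_uniq //; exact: val_inj.
- by move=> /memL[u [x [-> -> /inc ->]]] /=.
- have : Ordinal wn != r by rewrite -val_eqE /= r0 -lt0n.
  move/implyP: (pT (Ordinal wn)) => /[apply] /cards1P[u] /setP/(_ u).
  by rewrite !inE eqxx => uw; exists u; rewrite LE; apply/mapP; exists (Ordinal wn).
- move=> /memL[u [x [-> -> ux]]] /memL[u' [x' [-> /val_inj <- u'x]]].
  have xr : x != r by apply: contraTneq ux => ->.
  move/implyP: (pT x) => /(_ xr)/cards1P[z] /setP e.
  by have := e u; have := e u'; rewrite !inE ux u'x => /esym/eqP-> /esym/eqP->.
Qed.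

Definition history_tree m s : child_lists m.+1 := tree_of m (children s).

Lemma history_tree_inj m : {in histories m &, injective (@history_tree m)}.
Proof.
move=> s s' hs hs' e; apply: (children_inj hs hs') => v.
have sysL := children_child_system hs; have sysL' := children_child_system hs'.
have [vm|vm] := ltnP v m.+1.
  by rewrite -[v]/(val (Ordinal vm)) -!tree_ofE // -!/(history_tree m _) e.
(* The trees only record the lists of labels up to [m]; beyond, both lists are empty. *)
have nil t : child_system m.+1 (children t) -> children t v = [::].
  move=> [_ rt _ _]; have := rt v; case: (children t v) => // w l /(_ w).
  rewrite mem_head => /(_ isT)/andP[vw wm].
  by have := leq_trans (ltn_trans vw wm) vm; rewrite ltnn.
by rewrite !nil.
Qed.

(** Carries the uniform law on trees over to histories through the bijection. *)
Lemma count_history_tree m (E : pred (child_lists m.+1)) :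
  #|[set T in plane_increasing_trees m.+1 | E T]%SET| =
  count (fun s => E (history_tree m s)) (histories m).
Proof.
rewrite -(count_map (history_tree m) E) -sum1_count -sum1_card.
rewrite (eq_bigl (fun T => (T \in plane_increasing_trees m.+1) && E T)); last first.
  by move=> T; rewrite inE.
rewrite -big_enum_cond; apply: perm_big; apply: uniq_perm.
- exact: enum_uniq.
- by rewrite (map_inj_in_uniq (@history_tree_inj m)) histories_uniq.
move=> T; rewrite mem_enum inE.
apply/idP/mapP => [/tree_of_surj[L sysL ->]|[s hs ->]].
  have [s hs e] := children_surj sysL; exists s => //.
  by apply/ffunP => u; rewrite !ffunE e.
exact: tree_of_plane_increasing (children_child_system hs).
Qed.

Lemma tree_of_increasing m L : child_system m.+1 L -> increasing (tree_of m L).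
Proof. by move/tree_of_plane_increasing => /existsP[r /and3P[]]. Qed.

Lemma leaf_tree_of m L (u : 'I_m.+1) : child_system m.+1 L ->
  leaf (tree_of m L) u = nilp (L u).
Proof. by move=> sysL; rewrite /leaf /nilp -tree_ofE // size_map. Qed.

Lemma rank_tree_of_le m L (v : 'I_m.+1) p : child_system m.+1 L ->
  left_path L v p -> (rank (tree_of m L) v <= size p)%N.
Proof.
move=> sysL /andP[pp lp]; have [_ rL _ _] := sysL.
have [_] := rankP v (tree_of_increasing sysL); apply.
apply/existsP; exists (map_tuple inord (in_tuple p)) => /=.
elim: p v pp lp => [|w p IH] v /=; first by rewrite leaf_tree_of.
case/andP=> /eqP hv pp lp.
have wv : w \in L v by case: (L v) hv => // a l [->]; rewrite mem_head.
have /andP[_ wm] := rL _ _ wv.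
rewrite -andbA; apply/andP; split; first by rewrite /child /= mem_tree_of //= inordK.
by apply: IH; rewrite inordK.
Qed.

(** The leftmost path from a vertex of maximal rank reaches a leaf, so it has at least [k] edges,
    hence more than [k] vertices. *)
Lemma max_rank_left_path m k s : s \in histories m ->
  (k <= max_rank (history_tree m s))%N -> (0 < long_left_paths k s)%N.
Proof.
move=> hs; rewrite /max_rank.
have [|v ->] := @bigop.eq_bigmax _ (rank (history_tree m s)).
  by rewrite card_ord.
move=> kr; have [p pin pL] := left_paths_exist hs (ltn_ord v).
rewrite -has_count; apply/hasP; exists (val v :: p) => //=; rewrite ltnS.
apply: leq_trans kr _; apply: rank_tree_of_le pL.
exact: children_child_system.
Qed.

(** Every descent from [c 0] has to follow the chain, and no [c j] with [j < k] is a leaf. *)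
Lemma max_rank_chain m k c s : increasing_upto k c -> (c k <= m)%N ->
    s \in histories m -> rect (chain_slot k c) s ->
  (k <= max_rank (history_tree m s))%N.
Proof.
move=> ci ck hs rs; have sysL := children_child_system hs.
have c0 : (c 0%N < m.+1)%N by rewrite ltnS (chain_le ci ck).
apply: (@leq_trans (rank (history_tree m s) (Ordinal c0))); last first.
  by rewrite /max_rank (bigD1 (Ordinal c0)) //= leq_maxl.
have [/existsP[p /andP[pp lp]] _] := rankP (Ordinal c0) (tree_of_increasing sysL).
rewrite leqNgt; apply/negP => rk.
have key (q : seq 'I_m.+1) : path (child (history_tree m s)) (Ordinal c0) q ->
    (size q <= k)%N -> val (last (Ordinal c0) q) = c (size q).
  elim/last_ind: q => [//|q w IH]; rewrite rcons_path size_rcons last_rcons.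
  move=> /andP[pq]; rewrite /child /= mem_tree_of // => wq qk.
  move: wq; rewrite (IH pq (ltnW qk)) (chain_children ci ck hs rs _ (ltnW qk)).
  by move=> /andP[_ /eqP].
move: lp; rewrite leaf_tree_of // key ?size_tuple //; last exact: ltnW.
have := chain_children ci ck hs rs
  (c (rank (history_tree m s) (Ordinal c0)).+1) (ltnW rk).
by rewrite rk eqxx /=; case: (children s _).
Qed.

(** * Expectations over uniform histories, first and second moments *)

Section Mean.
Variable R : realType.
Implicit Types f g : seq slot -> R.

Definition mean (m : nat) f : R :=
  (\sum_(s <- histories m) f s) / (size (histories m))%:R.

Lemma size_histories_gt0 m : (0 < size (histories m))%N.
Proof. by elim: m => // m IH; rewrite size_histories muln_gt0. Qed.

Lemma size_histories_neq0 m : (size (histories m))%:R != 0 :> R.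
Proof. by rewrite pnatr_eq0 -lt0n size_histories_gt0. Qed.

Lemma uniform_finprob_mean m (E : pred (child_lists m.+1)) :
  uniform_finprob R (plane_increasing_trees m.+1) E =
  mean m (fun s => (E (history_tree m s))%:R).
Proof.
have cT : #|plane_increasing_trees m.+1| = size (histories m).
  rewrite -(count_predT (histories m)) -(count_history_tree predT).
  by apply: eq_card => T; rewrite !inE andbT.
rewrite /uniform_finprob /mean cT count_history_tree; congr (_ / _).
by rewrite -sum1_count natr_sum big_mkcond; apply: eq_bigr => s _; case: (E _).
Qed.

Lemma mean_le m f g : {in histories m, forall s, f s <= g s} -> mean m f <= mean m g.
Proof.
by move=> h; rewrite ler_wpM2r ?invr_ge0 // !big_seq ler_sum.
Qed.

Lemma eq_mean m f g : {in histories m, f =1 g} -> mean m f = mean m g.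
Proof. by move=> h; congr (_ / _); apply: eq_big_seq. Qed.

Lemma meanD m f g : mean m (fun s => f s + g s) = mean m f + mean m g.
Proof. by rewrite /mean big_split mulrDl. Qed.

Lemma meanZ m a f : mean m (fun s => a * f s) = a * mean m f.
Proof. by rewrite /mean -mulr_sumr mulrA. Qed.

Lemma mean_cst m a : mean m (fun=> a) = a.
Proof.
rewrite /mean big_const_seq count_predT iter_addr_0 -[a *+ _]mulr_natr mulfK //.
exact: size_histories_neq0.
Qed.

Lemma mean_sum m (I : finType) (F : I -> seq slot -> R) :
  mean m (fun s => \sum_i F i s) = \sum_i mean m (F i).
Proof. by rewrite /mean exchange_big mulr_suml. Qed.

Lemma mean_rect m A : mean m (fun s => (rect A s)%:R) =
  \prod_(i < m) ((count (A i.+1) (slots i.+1))%:R / (size (slots i.+1))%:R).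
Proof.
rewrite prodf_div -!natr_prod -count_rect /mean; congr (_ / _).
  rewrite -sum1_count natr_sum [RHS]big_mkcond.
  by apply: eq_bigr => s _; case: (rect _ _).
congr (_%:R); rewrite -(count_predT (histories m)).
under [RHS]eq_bigr => i _ do rewrite -count_predT.
rewrite -(count_rect m (fun _ => predT)); apply: eq_count => s /=.
by elim: s => //= x s <-.
Qed.

Lemma max_rank_upper_tail m k :
  mean m (fun s => (k <= max_rank (history_tree m s))%:R) <=
  m.+1%:R / (k.+1)`!%:R.
Proof.
apply: (@le_trans _ _ (mean m (fun s => (long_left_paths k s)%:R))).
  apply: mean_le => s hs; rewrite ler_nat.
  by case: (boolP (k <= max_rank _)%N) => // h; exact: max_rank_left_path hs h.
rewrite /mean -natr_sum ler_pdivrMr ?ltr0n ?size_histories_gt0 //.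
rewrite mulrAC ler_pdivlMr ?ltr0n ?fact_gt0 // -!natrM ler_nat.
exact: long_left_paths_bound.
Qed.

(** Chebyshev's inequality at the value 0: where [X] vanishes, [(X - mu) ^+ 2] equals [mu ^+ 2]. *)
Lemma second_moment m (X : seq slot -> R) :
  mean m (fun s => (X s == 0)%:R) * mean m X ^+ 2 <=
  mean m (fun s => X s ^+ 2) - mean m X ^+ 2.
Proof.
set mu := mean m X.
have -> : mean m (fun s => X s ^+ 2) - mu ^+ 2 = mean m (fun s => (X s - mu) ^+ 2).
  rewrite [RHS](@eq_mean m _ (fun s => X s ^+ 2 + ((- (2 * mu)) * X s + mu ^+ 2))).
    by rewrite !meanD meanZ mean_cst -/mu; ring.
  by move=> s _; ring.
rewrite mulrC -meanZ; apply: mean_le => s _.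
by case: eqP => [->|_]; rewrite ?mulr0 ?sqr_ge0 // mulr1 sub0r sqrrN.
Qed.

End Mean.

(** * Probabilities of isolated chains and the lower tail *)

Section ChainProbability.
Variable R : realType.

Lemma prod_if_mem m (l : seq nat) (a : R) :
  exists2 e, (e <= size l)%N & \prod_(i < m) (if i.+1 \in l then a else 1) = a ^+ e.
Proof.
exists #|[pred i : 'I_m | i.+1 \in l]|; last by rewrite -big_mkcond prodr_const.
rewrite cardE -(size_map (fun i : 'I_m => i.+1)); apply: uniq_leq_size.
  by rewrite map_inj_uniq ?enum_uniq // => i j [/val_inj].
by move=> _ /mapP[i + ->]; rewrite mem_enum.
Qed.

Section Bounds.
Variables (k m : nat).
Let n : R := m.+1%:R.
Let x : R := (k.+1.*2)%:R / n.
Hypothesis x_lt1 : x < 1.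

Let x_ge0 : 0 <= x. Proof. by rewrite divr_ge0. Qed.

Let size_slotsR i : (size (slots i.+1))%:R = i.*2.+1%:R :> R.
Proof. by rewrite size_slots. Qed.

(** A chain in the last half of the labels constrains only vertices that have at least [n] slots to
    choose from, so a share of at most [x] is forbidden. *)
Lemma chain_slot_freq c i : increasing_upto k c -> (m.+1 <= (c 0).*2)%N ->
    i.+1 \notin chain_image k c ->
  1 - x <= (count (chain_slot k c i.+1) (slots i.+1))%:R / (size (slots i.+1))%:R.
Proof.
move=> c_incr mc ni.
have r0 : 0 < (size (slots i.+1))%:R :> R by rewrite size_slotsR ltr0n.
have [ic|ci] := leqP i.+1 (c 0%N).
  by rewrite count_chain_slot0 // divff ?gerBl ?gt_eqF.
rewrite ler_pdivlMr // mulrBl mul1r lerBlDr.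
apply: (@le_trans _ _ ((count (chain_slot k c i.+1) (slots i.+1))%:R + k.+1.*2%:R)).
  by rewrite -natrD ler_nat; exact: count_chain_slot.
rewrite lerD2l /x mulrAC ler_pdivlMr ?ltr0n // ler_wpM2l // /n size_slotsR ler_nat.
by move: mc ci; rewrite -!addnn; lia.
Qed.

(** Each label is charged a factor [1 - x], and each label with a forced slot a further
    [1 / (2n)]. *)
Lemma chain_prob_ge c : increasing_upto k c -> (m.+1 <= (c 0).*2)%N ->
  (1 - x) ^+ m / (n *+ 2) ^+ k <=
  mean m (fun s => (rect (chain_slot k c) s)%:R) :> R.
Proof.
move=> ci mc; rewrite mean_rect.
have nE : n *+ 2 = (m.+1.*2)%:R by rewrite /n -muln2 natrM mulr_natr.
have n2 : 1 <= n *+ 2 by rewrite nE ler1n.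
have n2_gt0 : 0 < n *+ 2 by apply: lt_le_trans n2.
apply: (@le_trans _ _ (\prod_(i < m) ((1 - x) *
    (if i.+1 \in chain_image k c then (n *+ 2)^-1 else 1)))).
  rewrite big_split prodr_const card_ord; have [e el ->] :=
    prod_if_mem m (chain_image k c) (n *+ 2)^-1.
  rewrite ler_wpM2l ?exprn_ge0 ?subr_ge0 ?(ltW x_lt1) // exprVn.
  rewrite lef_pV2 ?posrE ?exprn_gt0 //; apply: ler_weXn2l => //.
  by apply: leq_trans el _; rewrite size_map size_iota.
apply: ler_prod => i _; apply/andP; split.
  rewrite mulr_ge0 ?subr_ge0 ?(ltW x_lt1) //.
  by case: ifP; rewrite ?invr_ge0 ?(ltW n2_gt0).
case: ifPn => [im|ni].
  rewrite count_chain_slot_image // mul1r size_slotsR.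
  apply: (@le_trans _ _ (n *+ 2)^-1).
    by rewrite ler_piMl ?invr_ge0 ?(ltW n2_gt0) // gerBl.
  rewrite lef_pV2 ?posrE ?ltr0n // nE ler_nat.
  by have := ltn_ord i; rewrite -!addnn; lia.
by rewrite mulr1; exact: chain_slot_freq.
Qed.

(** Compared label by label: a label forced by neither chain gives negative correlation, and each of
    the at most [2k] forced labels costs a factor [(1 - x)^-1]. *)
Lemma chain_pair_prob_le c c' : increasing_upto k c -> increasing_upto k c' ->
    (m.+1 <= (c 0).*2)%N -> (m.+1 <= (c' 0).*2)%N ->
    (forall j j', j <= k -> j' <= k -> c j != c' j')%N ->
  mean m (fun s => (rect (chain_slot k c) s && rect (chain_slot k c') s)%:R) <=
  mean m (fun s => (rect (chain_slot k c) s)%:R) *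
  mean m (fun s => (rect (chain_slot k c') s)%:R) * (1 - x)^-1 ^+ k.*2 :> R.
Proof.
move=> ci ci' mc mc' dis.
have g1 : 1 <= (1 - x)^-1 by rewrite invf_ge1 ?subr_gt0 // gerBl.
rewrite (eq_mean (g := fun s =>
    (rect (fun i y => chain_slot k c i y && chain_slot k c' i y) s)%:R)); last first.
  by move=> s _; rewrite rectI.
rewrite !mean_rect -big_split /=.
have [e el eE] := prod_if_mem m (chain_image k c ++ chain_image k c') (1 - x)^-1.
apply: (@le_trans _ _ (\prod_(i < m) (
    (count (chain_slot k c i.+1) (slots i.+1))%:R / (size (slots i.+1))%:R *
    ((count (chain_slot k c' i.+1) (slots i.+1))%:R / (size (slots i.+1))%:R) *
    (if i.+1 \in chain_image k c ++ chain_image k c' then (1 - x)^-1 else 1)))).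
  2:{ rewrite big_split eE ler_wpM2l //.
        by apply: prodr_ge0 => i _; rewrite mulr_ge0 // divr_ge0.
      apply: ler_weXn2l => //; apply: leq_trans el _.
      by rewrite size_cat !size_map !size_iota addnn. }
apply: ler_prod => i _; rewrite divr_ge0 // andTb.
have sep d d' : (forall j j', j <= k -> j' <= k -> d j != d' j')%N ->
    i.+1 \in chain_image k d -> i.+1 \notin chain_image k d'.
  move=> dd /mapP[j]; rewrite mem_iota => /andP[_ jk] ->.
  apply/negP => /mapP[j']; rewrite mem_iota => /andP[_ j'k] e'.
  by have := dd j.+1 j'.+1 jk j'k; rewrite e' eqxx.
have r0 : 0 < (size (slots i.+1))%:R :> R by rewrite size_slotsR ltr0n.
have half d d' : increasing_upto k d -> increasing_upto k d' ->
    (m.+1 <= (d 0).*2)%N -> (m.+1 <= (d' 0).*2)%N ->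
    (forall j j', j <= k -> j' <= k -> d j != d' j')%N ->
    i.+1 \in chain_image k d ->
  (count (fun y => chain_slot k d i.+1 y && chain_slot k d' i.+1 y) (slots i.+1))%:R
     / (size (slots i.+1))%:R <=
  (count (chain_slot k d i.+1) (slots i.+1))%:R / (size (slots i.+1))%:R *
    ((count (chain_slot k d' i.+1) (slots i.+1))%:R / (size (slots i.+1))%:R) *
    (1 - x)^-1 :> R.
  move=> di di' md md' dd im; rewrite -mulrA count_chain_slot_image //.
  apply: (@le_trans _ _ (1%:R / (size (slots i.+1))%:R)).
    rewrite ler_wpM2r ?invr_ge0 // ler_nat -(count_chain_slot_image di im).
    by apply: sub_count => y /andP[].
  rewrite ler_peMr ?divr_ge0 // ler_pdivlMr ?subr_gt0 // mul1r.
  by apply: chain_slot_freq => //; exact: sep im.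
rewrite mem_cat; have [im|ni] := boolP (i.+1 \in chain_image k c); first exact: half.
have [im|ni'] := boolP (i.+1 \in chain_image k c').
  rewrite [X in _ <= X * _]mulrC.
  rewrite (eq_count
    (a2 := fun y => chain_slot k c' i.+1 y && chain_slot k c i.+1 y)).
    by apply: half => // j j' jk j'k; rewrite eq_sym dis.
  by move=> y; rewrite andbC.
rewrite mulr1 mulf_div ler_pdivlMr ?mulr_gt0 // mulrA divfK ?gt_eqF //.
rewrite -!natrM ler_nat.
exact: count_chain_slot_disjoint.
Qed.

End Bounds.

(** Block [j] consists of the [b] labels from [N + j * b] on, and [f] gives the offset of the chosen
    vertex in each block. *)
Definition block_chain (k b N : nat) (f : {ffun 'I_k.+1 -> 'I_b}) (j : nat) : nat :=
  (N + j * b + f (inord j))%N.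

Lemma block_chain_lt k b N (f g : {ffun 'I_k.+1 -> 'I_b}) i j :
  (i < j)%N -> (block_chain N f i < block_chain N g j)%N.
Proof.
move=> ij; rewrite /block_chain; apply: (@leq_trans (N + i.+1 * b)).
  by rewrite -addnA ltn_add2l mulSn addnC ltn_add2r.
by rewrite -addnA leq_add2l (leq_trans _ (leq_addr _ _)) // leq_mul2r ij orbT.
Qed.

Lemma block_chain_le k b N (f : {ffun 'I_k.+1 -> 'I_b}) :
  (block_chain N f k < N + k.+1 * b)%N.
Proof. by rewrite /block_chain -addnA ltn_add2l mulSn addnC ltn_add2r. Qed.

Lemma block_chain_neq k b N (f g : {ffun 'I_k.+1 -> 'I_b}) :
    (forall j, f j != g j) ->
  forall i j, (i <= k -> j <= k -> block_chain N f i != block_chain N g j)%N.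
Proof.
move=> fg i j ik jk; case: (ltngtP i j) => [ij|ji|->].
- by rewrite ltn_eqF // block_chain_lt.
- by rewrite gtn_eqF // block_chain_lt.
- by rewrite /block_chain eqn_add2l val_eqE fg.
Qed.

(** Second moment method for the number [X] of realised chains among the [b ^ k.+1] block chains:
    [X = 0] has probability at most [1 / mu + (G - 1)]. *)
Lemma max_rank_lower_tail k m b : (0 < b)%N -> ((k.+1 * b).*2 <= m.+1)%N ->
    let x := (k.+1.*2)%:R / m.+1%:R : R in x < 1 ->
  mean m (fun s => (max_rank (history_tree m s) < k)%:R) <=
  (b%:R ^+ k.+1 * ((1 - x) ^+ m / (m.+1%:R *+ 2) ^+ k))^-1 +
  ((1 - x)^-1 ^+ k.*2 - 1) :> R.
Proof.
move=> b0 bm x x1; set N := (m.+1 - k.+1 * b)%N.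
have N2 : (m.+1 <= N.*2)%N by rewrite /N; move: bm; rewrite -!addnn; lia.
pose c (f : {ffun 'I_k.+1 -> 'I_b}) := block_chain N f.
have ci f : increasing_upto k (c f) by move=> i j /andP[ij _]; exact: block_chain_lt.
have ck f : (c f k <= m)%N.
  have := block_chain_le N f; rewrite /N subnK ?ltnS //.
  by apply: leq_trans bm; rewrite -addnn leq_addr.
have cN f : (m.+1 <= (c f 0).*2)%N.
  by apply: leq_trans N2 _; rewrite leq_double /c /block_chain -addnA leq_addr.
pose p f : R := mean m (fun s => (rect (chain_slot k (c f)) s)%:R).
pose X s : R := \sum_f (rect (chain_slot k (c f)) s)%:R.
pose mu := mean m X; have muE : mu = \sum_f p f by rewrite /mu mean_sum.
set G := (1 - x)^-1 ^+ k.*2; set q := (1 - x) ^+ m / _.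
have q0 : 0 < q by rewrite divr_gt0 ?exprn_gt0 ?subr_gt0 ?mulrn_wgt0 ?ltr0n.
have p_ge f : q <= p f by exact: chain_prob_ge.
have p0 f : 0 <= p f by exact: le_trans (ltW q0) (p_ge f).
have mu_ge : b%:R ^+ k.+1 * q <= mu.
  have cE : #|{: {ffun 'I_k.+1 -> 'I_b}}| = (b ^ k.+1)%N.
    by rewrite card_ffun !card_ord.
  by rewrite muE -natrX -cE mulr_natl -sumr_const; apply: ler_sum => f _.
have bq0 : 0 < b%:R ^+ k.+1 * q by rewrite mulr_gt0 ?exprn_gt0 ?ltr0n.
have mu0 : 0 < mu by exact: lt_le_trans mu_ge.
have G0 : 0 <= G by rewrite exprn_ge0 ?invr_ge0 ?subr_ge0 ?ltW.
(* The diagonal pairs contribute [mu], the disjoint pairs at most [G * mu ^+ 2], the other pairs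
   nothing. *)
have X2 : mean m (fun s => X s ^+ 2) <= mu + G * mu ^+ 2.
  have -> : mean m (fun s => X s ^+ 2) = \sum_f \sum_g mean m (fun s =>
      (rect (chain_slot k (c f)) s && rect (chain_slot k (c g)) s)%:R).
    under [RHS]eq_bigr => f _ do rewrite -mean_sum.
    rewrite -mean_sum; apply: eq_mean => s _.
    rewrite expr2 /X mulr_suml; apply: eq_bigr => f _; rewrite mulr_sumr.
    by apply: eq_bigr => g _; rewrite -natrM mulnb.
  rewrite muE expr2 mulr_suml mulr_sumr -big_split; apply: ler_sum => f _ /=.
  rewrite mulr_sumr mulr_sumr (bigD1 f) //=; apply: lerD.
    rewrite (eq_mean (g := fun s => (rect (chain_slot k (c f)) s)%:R)) // => s _.
    by rewrite andbb.
  rewrite [leRHS](bigD1 f) //= -[leLHS]add0r; apply: lerD.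
    by rewrite mulr_ge0 // mulr_ge0.
  apply: ler_sum => g gf.
  have [/forallP fg|] := boolP [forall j, f j != g j].
    rewrite mulrC; apply: chain_pair_prob_le => //; exact: block_chain_neq.
  (* Two distinct chains with a common vertex in block [j] cannot both be realised, by
     [rect_chain_inj]. *)
  rewrite negb_forall => /existsP[j /negPn /eqP fgj].
  apply: (@le_trans _ _ 0); last by rewrite mulr_ge0 // mulr_ge0.
  rewrite -(mean_cst m (0 : R)); apply: mean_le => s hs; rewrite lern0 eqb0.
  apply/negP => /andP[rf rg]; case/eqP: gf; apply/ffunP => i.
  have := rect_chain_inj (ci f) (ci g) (ck f) (ck g) hs rf rg.
  move=> /(_ j (ltn_ord j)); rewrite /c /block_chain inord_val fgj.
  move=> /(_ erefl i (ltn_ord i)).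
  by rewrite inord_val => /eqP; rewrite eqn_add2l val_eqE => /eqP.
have := second_moment m X; rewrite -/mu => sm.
apply: (@le_trans _ _ (mean m (fun s => (X s == 0)%:R))).
  apply: mean_le => s hs; rewrite ler_nat; case: (ltnP _ k) => // rk.
  rewrite [X s]big1 ?eqxx // => f _; case: (boolP (rect _ s)) => // rf.
  by have := max_rank_chain (ci f) (ck f) hs rf; rewrite leqNgt rk.
apply: (@le_trans _ _ (mu^-1 + (G - 1))); last first.
  by rewrite lerD2r lef_pV2 ?posrE.
rewrite -(ler_pM2r (exprn_gt0 2 mu0)); apply: le_trans sm _.
have -> : (mu^-1 + (G - 1)) * mu ^+ 2 = mu + G * mu ^+ 2 - mu ^+ 2.
  by field; rewrite gt_eqF.
by rewrite lerD2r.
Qed.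

End ChainProbability.

(** * Asymptotics *)

Section Rates.
Variable R : realType.

Lemma fact_ge_pow (K : nat) : K%:R ^+ K <= expR K%:R * K`!%:R :> R.
Proof.
case: K => [|K]; first by rewrite expr0 expR0 mul1r.
rewrite -ler_pdivrMr ?ltr0n ?fact_gt0 //; apply: le_trans (expR_ge1Dxn K _) => //.
by rewrite lerDr.
Qed.

(** Here [t] stands for [log log n], so [expR t] is [log n] and [expR (expR t)] is [n]. The exponent
    gained is [27/20 + 9/10 * eps] times [log n], against the required [1 + 99/100 * eps]. *)
Lemma fact_rate (eps t : R) (K : nat) : 0 < eps < 1 -> 400 <= t ->
    (3 / 2 + eps) * (expR t / t) <= K%:R ->
  expR (expR t) / K`!%:R <= expR (- (99 / 100 * eps * expR t)).
Proof.
move=> /andP[e0 e1] t400 hK; set l := expR t in hK *.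
have t0 : 0 < t by lra.
have l0 : 0 < l := expR_gt0 t.
have u0 : 0 < l / t by rewrite divr_gt0.
have Kl : l / t <= K%:R by apply: le_trans hK; rewrite ler_peMl ?(ltW u0) //; lra.
have K0 : 0 < K%:R :> R := lt_le_trans u0 Kl.
(* From [ln (1 + y) <= y] at [y = 19] and [y = t / 20 - 1]; for [400 <= t] it yields
   [ln K - 1 >= 9/10 * t]. *)
have lnt : ln t <= 19 + t / 20 - 1.
  have -> : ln t = ln 20 + ln (t / 20).
    by rewrite -lnM ?posrE ?divr_gt0 //; congr ln; field.
  have := @le_ln1Dx R 19; have := @le_ln1Dx R (t / 20 - 1).
  rewrite subrKC (_ : 1 + 19 = 20 :> R); last by ring.
  by move=> h1 h2; apply: (le_trans (lerD (h2 _) (h1 _))); lra.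
have lnK' : t - ln t <= ln K%:R.
  by rewrite -[X in X - _](expRK t) -ln_div ?posrE // ler_ln ?posrE.
have KK : expR (K%:R * (ln K%:R - 1)) <= K`!%:R :> R.
  rewrite mulrBr mulr1 expRD expRN ler_pdivrMr ?expR_gt0 // [leRHS]mulrC.
  rewrite expRM_natl lnK //.
  exact: fact_ge_pow.
rewrite ler_pdivrMr ?ltr0n ?fact_gt0 //.
apply: le_trans (ler_wpM2l (expR_ge0 _) KK); rewrite -expRD ler_expR.
have h3 : (3 / 2 + eps) * (l / t) * (9 / 10 * t) <= K%:R * (ln K%:R - 1).
  by apply: ler_pM => //; [rewrite mulr_ge0 ?(ltW u0) //|..]; lra.
have h4 : (3 / 2 + eps) * (l / t) * (9 / 10 * t) = (27 / 20 + 9 / 10 * eps) * l.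
  by field; rewrite gt_eqF.
have : eps * l <= l by rewrite ger_pMl // ltW.
have : 0 <= eps * l by rewrite mulr_ge0 // ltW.
rewrite h4 in h3; lra.
Qed.

(** Same meaning of [t]. The [+ 2] leaves room for rounding up and for a chain having one vertex
    more than edges. *)
Lemma chain_rate (eps t : R) (K : nat) : 0 < eps < 1 -> 2000 <= eps * t ->
    K%:R <= (1 - eps) * (expR t / t) + 2 ->
  (8 * K%:R) ^+ K * expR (4 * K%:R) <=
  expR (expR t) * expR (- (99 / 100 * eps * expR t)).
Proof.
move=> /andP[e0 e1] et hK; set l := expR t in hK *.
have t0 : 0 < t by rewrite -(pmulr_rgt0 t e0); lra.
have t1 : 2000 <= t by apply: le_trans et _; rewrite ger_pMl // ltW.
have lt2 : t ^+ 2 / 4 <= l.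
  have := expR_ge1Dxn 1 (ltW t0); rewrite -/l (_ : 2`! = 2)%N // => h.
  by have : 0 <= t ^+ 2 := sqr_ge0 t; lra.
set u := l / t in hK; have lE : l = u * t by rewrite divfK ?gt_eqF.
have ut : t / 4 <= u by rewrite ler_pdivlMr // mulrAC -expr2.
have Kl : K%:R <= l by rewrite lE; nra.
(* The exponent combines the given [4] with [8 <= expR 3] and [K <= expR t]. *)
apply: (@le_trans _ _ (expR (K%:R * (7 + t)))); last first.
  rewrite -expRD ler_expR.
  have h : K%:R * (7 + t) <= ((1 - eps) * u + 2) * (7 + t).
    by rewrite ler_wpM2r //; lra.
  apply: le_trans h _; rewrite lE.
  (* The spare hundredth of [eps * l] is at least [20 * u], which covers the error
     [7 * u + 14 + 2 * t] because [t <= 4 * u] and [u] is large. *)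
  have : 2000 * u <= eps * t * u by rewrite ler_wpM2r //; lra.
  nra.
have -> : K%:R * (7 + t) = K%:R * (3 + t) + 4 * K%:R by ring.
rewrite expRD ler_wpM2r ?expR_ge0 // expRM_natl.
apply: lerXn2r; rewrite ?nnegrE ?mulr_ge0 ?expR_ge0 //.
rewrite expRD; apply: ler_pM => //.
have -> : 3 = 3%:R * 1 :> R by ring.
rewrite expRM_natl; apply: (@le_trans _ _ (2 ^+ 3)); first lra.
by apply: lerXn2r; rewrite ?nnegrE ?expR_ge0 //; have := expR_ge1Dx (1 : R); lra.
Qed.

Lemma bernoulli_sub (j : nat) (x : R) : 0 <= x -> x <= 1 ->
  1 - j%:R * x <= (1 - x) ^+ j.
Proof.
move=> x0 x1; elim: j => [|j IH]; first by rewrite mul0r subr0.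
rewrite exprS; apply: (@le_trans _ _ ((1 - x) * (1 - j%:R * x))).
  have : 0 <= j%:R * x * x by rewrite !mulr_ge0.
  by rewrite -nat1r; lra.
by rewrite ler_wpM2l // subr_ge0.
Qed.

(** The previous tail bound with the longest blocks that fit into half of the labels; the first
    summand is the bound for [1 / mu], the second that for [G - 1]. *)
Lemma max_rank_lower_tail_exp k m : (0 < k)%N -> (8 * k.+1 ^ 2 <= m.+1)%N ->
  mean m (fun s => (max_rank (history_tree m s) < k)%:R) <=
  (8 * k.+1%:R) ^+ k.+1 * expR (4 * k.+1%:R) / m.+1%:R
  + 8 * k.+1%:R ^+ 2 / m.+1%:R :> R.
Proof.
move=> k0 km; set n : R := m.+1%:R; set q : R := k.+1%:R.
have n0 : 0 < n by rewrite ltr0n.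
have q2 : 2 <= q by rewrite ler_nat ltnS.
have q0 : 0 < q by lra.
have qn : 8 * q ^+ 2 <= n by rewrite /q /n -natrX -natrM ler_nat.
set b := (m.+1 %/ k.+1.*2)%N.
have bm : ((k.+1 * b).*2 <= m.+1)%N by rewrite doubleMl mulnC leq_trunc_div.
(* Rounding [n / (2 * q)] down loses at most a factor 2, since the quotient is at least 1. *)
have bn : n / (4 * q) <= b%:R.
  have h : (m.+1 <= (b * k.+1.*2).*2)%N.
    have := ltn_ceil m.+1 (isT : 0 < k.+1.*2)%N; rewrite -/b mulSn => h.
    have b1 : (k.+1.*2 <= b * k.+1.*2)%N.
      rewrite leq_pmull // divn_gt0 //; apply: leq_trans km.
      by rewrite -addnn expnS expn1; nia.
    by rewrite -addnn; lia.
  rewrite ler_pdivrMr ?mulr_gt0 //.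
  rewrite /n /q; apply: (@le_trans _ _ (b * k.+1.*2).*2%:R).
    by rewrite ler_nat.
  by rewrite -!muln2 !natrM; lra.
have b0 : (0 < b)%N.
  by rewrite -(ltr_nat R); apply: lt_le_trans bn; rewrite divr_gt0 //; lra.
set x : R := (k.+1.*2)%:R / n.
have xE : x = 2 * q / n by rewrite /x -muln2 natrM [_ * 2]mulrC.
have x0 : 0 <= x by rewrite divr_ge0.
have qx : q * x <= 1 / 4.
  by rewrite xE mulrA ler_pdivrMr //; nra.
have x4 : x <= 1 / 8 by nra.
have x1 : x < 1 by lra.
apply: le_trans (max_rank_lower_tail b0 bm x1) _; apply: lerD.
  rewrite -/n -/x.
  have -> : (8 * q) ^+ k.+1 * expR (4 * q) / n =
     ((n / (8 * q)) ^+ k.+1 * (expR (- (4 * q)) / n ^+ k))^-1.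
    rewrite expRN expr_div_n [n ^+ k.+1]exprS.
    have: (8 * q) ^+ k.+1 != 0 by rewrite expf_neq0 // mulf_neq0 // gt_eqF.
    have: expR (4 * q) != 0 by rewrite gt_eqF // expR_gt0.
    have: n ^+ k != 0 by rewrite expf_neq0 // gt_eqF.
    move: (n ^+ k) (expR _) (_ ^+ k.+1) => a b' c a0 b'0 c0.
    by field; rewrite a0 b'0 c0 gt_eqF.
  rewrite lef_pV2 ?posrE; last 2 first.
  - apply: mulr_gt0; first by rewrite exprn_gt0 // ltr0n.
    by apply: divr_gt0; apply: exprn_gt0; rewrite ?subr_gt0 ?mulrn_wgt0.
  - by apply: mulr_gt0; [apply: exprn_gt0|]; apply: divr_gt0;
      rewrite ?mulr_gt0 ?expR_gt0 ?exprn_gt0.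
  have -> : (n / (8 * q)) ^+ k.+1 * (expR (- (4 * q)) / n ^+ k) =
     (n / (4 * q)) ^+ k.+1 * ((expR (- (4 * q)) / 2) / (n *+ 2) ^+ k).
    have -> : n / (8 * q) = n / (4 * q) / 2 by field; lra.
    rewrite -(mulr_natr n 2) [(n * 2) ^+ k]exprMn expr_div_n [2 ^+ k.+1]exprS.
    have: n ^+ k != 0 by rewrite expf_neq0 // gt_eqF.
    have: 2 ^+ k != 0 :> R by rewrite expf_neq0.
    move: (n ^+ k) (2 ^+ k) (_ ^+ k.+1) (expR _) => a b' c d a0 b'0.
    by field; rewrite a0 b'0.
  apply: ler_pM; first by rewrite exprn_ge0 // divr_ge0 ?mulr_ge0 ?ltW.
  - by rewrite !mulr_ge0 ?expR_ge0 ?invr_ge0 ?exprn_ge0 ?mulrn_wge0.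
  - by apply: lerXn2r => //; rewrite nnegrE // divr_ge0 // mulr_ge0.
  rewrite ler_wpM2r ?invr_ge0 ?exprn_ge0 ?mulrn_wge0 //.
  apply: (@le_trans _ _ (expR (- (4 * q)))).
    by have := expR_ge0 (- (4 * q)); lra.
  have inv1 : (1 - x)^-1 <= expR (2 * x).
    apply: le_trans (expR_ge1Dx _); rewrite invf_ple ?posrE; [|lra..].
    by rewrite -[leLHS]mul1r ler_pdivrMr; nra.
  rewrite expRN -[(1 - x) ^+ m]invrK lef_pV2 ?posrE ?expR_gt0 ?invr_gt0
    ?exprn_gt0 ?subr_gt0 //.
  rewrite -exprVn; apply: (@le_trans _ _ (expR (2 * x) ^+ m)).
    by apply: lerXn2r => //; rewrite nnegrE ?expR_ge0 // invr_ge0 subr_ge0 ltW.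
  rewrite -expRM_natl ler_expR xE; apply: (@le_trans _ _ (n * (2 * (2 * q / n)))).
    by rewrite ler_wpM2r ?mulr_ge0 ?invr_ge0 ?ltW ?ler_nat //; lra.
  by rewrite le_eqVlt; apply/orP; left; apply/eqP; field; rewrite gt_eqF.
rewrite -/n -/x exprVn lerBlDr.
(* As [2 * q * x <= 1/2], this gives [G <= 1 + 4 * (q * x)], where
   [4 * (q * x) = 8 * q ^+ 2 / n]. *)
have bern : 1 - 2 * q * x <= (1 - x) ^+ k.*2.
  apply: le_trans (bernoulli_sub k.*2 x0 (ltW x1)).
  by rewrite lerD2l lerN2 ler_wpM2r // -muln2 natrM mulrC ler_wpM2l // ler_nat.
have -> : 8 * q ^+ 2 / n = 4 * (q * x) by rewrite xE; field; rewrite gt_eqF.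
have qx0 : 0 <= q * x by rewrite mulr_ge0.
rewrite invf_ple ?posrE ?exprn_gt0 ?subr_gt0 //; last by lra.
apply: le_trans bern; rewrite -[leLHS]mul1r ler_pdivrMr; nra.
Qed.

End Rates.

(** Of the constant 3, one part is for the upper tail and two are for the two summands of the lower
    tail. *)
Lemma max_rank_tail_bound (R : realType) (eps T : R) (m : nat) :
    0 < eps < 1 -> 2000 <= eps * T -> expR (expR T) <= m.+1%:R ->
  mean m (fun s => (~~ (1 - eps <= (max_rank (history_tree m s))%:R /
      (ln m.+1%:R / ln (ln m.+1%:R)) <= 3 / 2 + eps))%:R) <=
  3 * expR (- (99 / 100 * eps * ln m.+1%:R)).
Proof.
move=> /[dup] e01 /andP[e0 e1] eT hn.
have n0 : 0 < m.+1%:R :> R by rewrite ltr0n.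
set l := ln _; set t := ln l.
have T0 : 0 < T by rewrite -(pmulr_rgt0 T e0); lra.
have T1 : 2000 <= T by apply: le_trans eT _; rewrite ger_pMl // ltW.
have lT : expR T <= l by rewrite -ler_expR lnK ?posrE.
have l0 : 0 < l := lt_le_trans (expR_gt0 _) lT.
have tT : T <= t by rewrite -ler_expR lnK ?posrE.
have et : 2000 <= eps * t by apply: le_trans eT _; rewrite ler_pM2l.
have t0 : 0 < t by lra.
have lE : expR t = l by rewrite lnK ?posrE.
have nE : expR l = m.+1%:R by rewrite lnK ?posrE.
have L0 : 0 < l / t by rewrite divr_gt0.
set k1 := (Num.truncn ((1 - eps) * (l / t))).+1.
set k2 := (Num.truncn ((3 / 2 + eps) * (l / t))).+1.
have k1_itv : k1%:R - 1 <= (1 - eps) * (l / t) < k1%:R.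
  rewrite /k1 -[in X in X - 1]natr1 addrK; apply: truncn_itv.
  by rewrite mulr_ge0 ?(ltW L0) //; lra.
have k2_gt : (3 / 2 + eps) * (l / t) < k2%:R by exact: truncnS_gt.
set D := expR _.
have up : mean m (fun s => (k2 <= max_rank (history_tree m s))%:R) <= D.
  apply: le_trans (max_rank_upper_tail R m k2) _.
  have := @fact_rate R eps t k2.+1 e01; rewrite lE nE -/D; apply; first by lra.
  by rewrite (le_trans (ltW k2_gt)) // ler_nat.
have low : mean m (fun s => (max_rank (history_tree m s) < k1)%:R) <= D + D.
  have hk : k1.+1%:R <= (1 - eps) * (l / t) + 2.
    by move/andP: k1_itv => [h _]; rewrite -natr1; lra.
  have := @chain_rate R eps t k1.+1 e01 et; rewrite lE nE -/D => /(_ hk) B.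
  (* The second summand is dominated by the first, as [k1.+1] is at least 2; with [D <= 1] this also
     yields the size condition [k8]. *)
  have B8 : 8 * k1.+1%:R ^+ 2 <= m.+1%:R * D.
    apply: le_trans B; rewrite -[leLHS]mulr1; apply: ler_pM => //.
      rewrite exprMn; apply: ler_pM; rewrite ?exprn_ge0 //.
        by rewrite exprS ler_peMr // exprn_ege1 //; lra.
      by apply: ler_weXn2l; rewrite ?ler1n.
    by rewrite -expR0 ler_expR mulr_ge0.
  have D1 : D <= 1.
    by rewrite -expR0 ler_expR oppr_le0 mulr_ge0 ?(ltW l0) // mulr_ge0 ?(ltW e0).
  have k8 : (8 * k1.+1 ^ 2 <= m.+1)%N.
    rewrite -(ler_nat R) natrM natrX; apply: le_trans B8 _.
    by rewrite ger_pMr.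
  apply: le_trans (max_rank_lower_tail_exp R _ k8) _ => //.
  by apply: lerD; rewrite ler_pdivrMr // [leRHS]mulrC.
apply: (@le_trans _ _ (mean m (fun s => (max_rank (history_tree m s) < k1)%:R +
    (k2 <= max_rank (history_tree m s))%:R))); last first.
  by rewrite meanD; lra.
apply: mean_le => s _; rewrite -natrD ler_nat.
have [_|rk1] := ltnP (max_rank (history_tree m s)) k1.
  exact: leq_trans (leq_b1 _) (leq_addr _ _).
have [_|rk2] := leqP k2 (max_rank (history_tree m s)).
  exact: leq_b1.
suff -> : 1 - eps <= (max_rank (history_tree m s))%:R / (l / t) <= 3 / 2 + eps by [].
rewrite ler_pdivlMr // ler_pdivrMr //; apply/andP; split.
  by move/andP: k1_itv => [_ /ltW /le_trans]; apply; rewrite ler_nat.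
apply: (@le_trans _ _ (Num.truncn ((3 / 2 + eps) * (l / t)))%:R).
  by rewrite ler_nat -ltnS.
have /truncn_itv /andP[] // : 0 <= (3 / 2 + eps) * (l / t).
by rewrite mulr_ge0 ?(ltW L0) //; lra.
Qed.

Theorem theorem3p13 (R : realType) (eps : R) (eps_gt0 : 0 < eps)
    (eps_lt1 : eps < 1) :
  (fun n : nat => 1 - uniform_finprob R (plane_increasing_trees n)
     (fun T => 1 - eps
               <= (max_rank T)%:R / (ln n%:R / ln (ln n%:R))
               <= 3 / 2 + eps))
  =O_\oo (fun n : nat => n%:R `^ (- (99 / 100 * eps))).
Proof.
have e01 : 0 < eps < 1 by rewrite eps_gt0.
apply/eqO_exP; exists 3 => //.
have [T eT] : exists T, 2000 <= eps * T.
  by exists (2000 / eps); rewrite mulrC divfK ?gt_eqF.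
(* Beyond this threshold [ln (ln n) >= T], so the iterated logarithm is positive and large enough
   for both rates. *)
exists (Num.truncn (expR (expR T))).+1 => // -[//|m] /= hm.
have hn : expR (expR T) <= m.+1%:R.
  by apply: le_trans (ltW (truncnS_gt _)) _; rewrite ler_nat.
rewrite uniform_finprob_mean.
set E := fun s => _; have -> : 1 - mean m E = mean m (fun s => 1 - E s).
  rewrite meanD mean_cst; congr (_ + _); rewrite -mulN1r -meanZ.
  by apply: eq_mean => s _; rewrite mulN1r.
have EE s : 1 - E s = (~~ (1 - eps <= (max_rank (history_tree m s))%:R /
      (ln m.+1%:R / ln (ln m.+1%:R)) <= 3 / 2 + eps))%:R.
  by rewrite /E; case: (_ <= _ <= _); rewrite ?subrr ?subr0.
rewrite [leRHS]/= ger0_norm; last first.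
  by rewrite -(mean_cst m (0 : R)); apply: mean_le => s _; rewrite EE.
rewrite ger0_norm ?powR_ge0 // /powR pnatr_eq0 /= mulNr.
by rewrite (eq_mean (fun s _ => EE s)); exact: max_rank_tail_bound hn.
Qed.
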